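(* Let $\mathfrak S=(\mathcal S,\mathcal U,T_{\mathfrak s})$ be a controlled Markov process with parity specification $\mathit{Parity}(\mathcal P)$, $\mathcal P=\langle B_1,\dots,B_\ell\rangle$, and let $\langle\mathcal G,\widehat{\mathcal P}\rangle$ be the abstract $2\frac12$-player parity game induced by $\mathfrak S$ (for a given priority-consistent finite partition $\widehat{\mathcal S}$ and given functions $\overline F,\underline F$ as described in the context). Suppose $\widehat s\in V_0$ and $\pi_0$ is a deterministic memoryless strategy of Player 0 such that for every strategy $\pi_1$ of Player 1, $P_{\widehat s}^{\pi_0,\pi_1}(\mathcal G\models\mathit{Parity}(\widehat{\mathcal P}))=1$. Then the refinement $\rho$ of $\pi_0$ satisfies $\widehat s\subseteq\mathsf{WinDom}(\mathfrak S,\rho)$.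
   Context: CMP: $\mathfrak S=(\mathcal S,\mathcal U,T_{\mathfrak s})$ with $\mathcal S$ a Borel space, $\mathcal U$ finite, and $T_{\mathfrak s}(\cdot\mid s,u)$ a probability measure on the Borel sets of $\mathcal S$ for each $s,u$. A stationary policy is a universally measurable $\rho:\mathcal S\to\mathcal U$; $P_s^\rho$ is the induced measure on infinite paths $(s^0,s^1,\dots)$ with $s^0=s$, $s^{k+1}\sim T_{\mathfrak s}(\cdot\mid s^k,\rho(s^k))$. $\mathcal P=\langle B_1,\dots,B_\ell\rangle$ is a partition of $\mathcal S$ into measurable sets (some possibly empty); a sequence satisfies $\mathit{Parity}(\mathcal P)$ iff for every odd $i$, if $B_i$ is visited infinitely often then some $B_j$ with $j>i$ even is visited infinitely often. $\mathsf{WinDom}(\mathfrak S,\rho)=\{s\mid P_s^\rho(\mathfrak S\models\mathit{Parity}(\mathcal P))=1\}$. Abstraction: $\widehat{\mathcal S}$ is a finite partition of $\mathcal S$ into nonempty (measurable) cells such that each cell is contained in a single $B_i$. $Q:\mathcal S\to\widehat{\mathcal S}$ maps $s$ to the cell containing it; $Q^{-1}(\widehat U)=\bigcup_{\widehat s\in\widehat U}\widehat s$. Functions $\overline F,\underline F:\widehat{\mathcal S}\times\mathcal U\to 2^{\widehat{\mathcal S}}$ satisfy $\overline F(\widehat s,u)\supseteq\{\widehat s'\mid\exists s\in\widehat s.\ T_{\mathfrak s}(\widehat s'\mid s,u)>0\}$ and $\underline F(\widehat s,u)\subseteq\{\widehat s'\mid\exists\varepsilon>0\ \forall s\in\widehat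 s.\ T_{\mathfrak s}(\widehat s'\mid s,u)\ge\varepsilon\}$. Game graph $\mathcal G=\langle V,E,\langle V_0,V_1,V_r\rangle\rangle$: $V_0=\widehat{\mathcal S}$, $V_1=\widehat{\mathcal S}\times\mathcal U$, $V_r=\bigcup_{v_1\in V_1}V_r(v_1)$ where $V_r(v_1)=\{v_r\subseteq\widehat{\mathcal S}\mid\underline F(v_1)\subseteq v_r\subseteq\overline F(v_1),\ 1\le|v_r|\le|\underline F(v_1)|+1\}$; edges: $E(v_0)=\{(v_0,u)\mid u\in\mathcal U\}$ for $v_0\in V_0$, $E(v_1)=V_r(v_1)$ for $v_1\in V_1$, $E(v_r)=\{v_0\in V_0\mid v_0\in v_r\}$ for $v_r\in V_r$. At $V_0$ (resp. $V_1$) vertices Player 0 (resp. Player 1) chooses a successor; at $V_r$ vertices the successor is chosen uniformly at random. Strategies of Player $i$ are maps $\pi_i:V^*V_i\to\mathit{Dist}(V)$ supported on successors of the last vertex; a deterministic memoryless Player 0 strategy assigns to each $v_0\in V_0$ a single successor $\pi_0(v_0)=(v_0,u)$. $P_v^{\pi_0,\pi_1}$ is the induced measure on runs. The abstract parity specification is $\widehat{\mathcal P}=\langle\widehat B_1,\dots,\widehat B_\ell\rangle$ with $\widehat B_i=\{v_0\in V_0\mid Q^{-1}(v_0)\subseteq B_i\}$; a run of $\mathcal G$ satisfies a specification over $V_0$ (here $\mathit{Parity}(\widehat{\mathcal P})$) iff its projection onto the subsequence of $V_0$-vertices satisfies it. Refinement: the refinement of a deterministic memoryless $\pi_0$ is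 the policy $\rho$ with $\rho(s)=u$ whenever $s\in\widehat s$ and $\pi_0(\widehat s)=(\widehat s,u)$. *)

(* Defs.v *)
From HB Require Import structures.
From mathcomp Require Import all_boot all_order all_algebra.
From mathcomp Require Import all_classical all_reals all_analysis.
From mathcomp Require Import measurable_realfun.
Set Implicit Arguments. Unset Strict Implicit. Unset Printing Implicit Defensive.
Import Order.TTheory GRing.Theory Num.Theory.
Local Open Scope classical_set_scope.
Local Open Scope ring_scope.

(* infinite sequences over X; the point x is only used to make the type a
   pointedType (required by MathComp-Analysis's measurable structures). *)
Definition runs (X : Type) (x : X) := nat -> X.
Arguments runs : clear implicits.
HB.instance Definition _ (X : Type) (x : X) := gen_eqMixin (runs X x).
HB.instance Definition _ (X : Type) (x : X) := gen_choiceMixin (runs X x).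
HB.instance Definition _ (X : Type) (x : X) :=
  isPointed.Build (runs X x) (fun _ => x).

Definition cyl_gen (X : Type) (x : X) (M : set (set X)) : set (set (runs X x)) :=
  [set E | exists n A, M A /\ E = [set w : runs X x | A (w n)]].
Arguments cyl_gen : clear implicits.

Definition pathspace (X : Type) (x : X) (M : set (set X)) :=
  g_sigma_algebraType (cyl_gen X x M).
Arguments pathspace : clear implicits.

Definition infinitely_often (p : nat -> Prop) : Prop :=
  forall m, exists n, (m <= n)%N /\ p n.

Definition parity_cond (X : Type) (ell : nat) (B : nat -> set X)
    (w : nat -> X) : Prop :=
  forall i, (1 <= i <= ell)%N -> odd i ->
    infinitely_often (fun n => B i (w n)) ->
    exists j, [/\ (i < j <= ell)%N, ~~ odd j &
                  infinitely_often (fun n => B j (w n))].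

(* cylF T rho [:: A_0; ...; A_n] s
     = 1_{A_0}(s) * \int T(ds_1|s,rho s) 1_{A_1}(s_1) * \int ... 1_{A_n}(s_n),
   i.e. the probability that the first n+1 states lie in A_0, ..., A_n. *)
Fixpoint cylF d (S : measurableType d) (R : realType) (U : Type)
    (T : S -> U -> probability S R) (rho : S -> U) (As : seq (set S))
    : S -> \bar R :=
  match As with
  | [::] => fun _ => 1%E
  | A :: As' => fun s =>
      ((\1_A s)%:E * \int[T s (rho s)]_(y in setT) cylF T rho As' y)%E
  end.

(* P is the measure P_s^rho on infinite paths (s^0, s^1, ...) of the CMP
   under the stationary policy rho, started at s (Ionescu-Tulcea measure,
   characterised by its values on measurable cylinders). *)
Definition is_path_measure d (S : measurableType d) (R : realType) (U : Type)
    (T : S -> U -> probability S R) (rho : S -> U) (s : S)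
    (P : probability (pathspace S point (@measurable d S)) R) : Prop :=
  forall As : seq (set S),
    (forall k, (k < size As)%N -> measurable (nth setT As k)) ->
    P [set w : runs S point | forall k, (k < size As)%N -> nth setT As k (w k)]
    = cylF T rho As s.

Definition WinDom d (S : measurableType d) (R : realType) (U : Type)
    (T : S -> U -> probability S R) (ell : nat) (B : nat -> set S)
    (rho : S -> U) : set S :=
  [set s | forall P : probability (pathspace S point (@measurable d S)) R,
      is_path_measure T rho s P ->
      P [set w : runs S point | parity_cond ell B w] = 1%E].

(* vertices: V_0 = cells C, V_1 = C * U, V_r = subsets of C
   (only those in some V_r(v_1) are reachable / are vertices of the game) *)
Definition gvertex (C U : finType) := (C + (C * U) + {set C})%type.
Arguments gvertex : clear implicits.
Definition gV0 (C U : finType) (c : C) : gvertex C U := inl (inl c).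
Definition gV1 (C U : finType) (c : C) (u : U) : gvertex C U := inl (inr (c, u)).
Definition gVr (C U : finType) (r : {set C}) : gvertex C U := inr r.
Arguments gV0 {C U}. Arguments gV1 {C U}. Arguments gVr {C U}.

Definition Vr_of (C U : finType) (Fup Flo : C -> U -> {set C}) (c : C) (u : U)
    (r : {set C}) : bool :=
  [&& Flo c u \subset r, r \subset Fup c u & (1 <= #|r| <= #|Flo c u| + 1)%N].

Definition gedge (C U : finType) (Fup Flo : C -> U -> {set C})
    (v v' : gvertex C U) : bool :=
  match v, v' with
  | inl (inl c), inl (inr (c', _)) => c' == c
  | inl (inr (c, u)), inr r => Vr_of Fup Flo c u r
  | inr r, inl (inl c) => c \in r
  | _, _ => false
  end.

(* a (randomised, history dependent) strategy of Player 1: given the history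
   (prefix h, current vertex (c,u) \in V_1) a distribution on V supported on
   the successors E((c,u)) *)
Definition p1_strategy (R : realType) (C U : finType)
    (Fup Flo : C -> U -> {set C})
    (pi1 : seq (gvertex C U) -> C * U -> gvertex C U -> R) : Prop :=
  [/\ forall h cu v, 0 <= pi1 h cu v,
      forall h cu, \sum_(v : gvertex C U) pi1 h cu v = 1 &
      forall h cu v, pi1 h cu v != 0 -> gedge Fup Flo (inl (inr cu)) v].

Definition gstep (R : realType) (C U : finType) (pi0 : C -> U)
    (pi1 : seq (gvertex C U) -> C * U -> gvertex C U -> R)
    (h : seq (gvertex C U)) (v v' : gvertex C U) : R :=
  match v with
  | inl (inl c) => ((v' == gV1 c (pi0 c)) : nat)%:R
  | inl (inr cu) => pi1 h cu v'
  | inr r => match v' with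
             | inl (inl c) => ((c \in r) : nat)%:R / (#|r|)%:R
             | _ => 0
             end
  end.

Fixpoint gpath (R : realType) (C U : finType) (pi0 : C -> U)
    (pi1 : seq (gvertex C U) -> C * U -> gvertex C U -> R)
    (h : seq (gvertex C U)) (v : gvertex C U) (ws : seq (gvertex C U)) : R :=
  match ws with
  | [::] => 1
  | w :: ws' => gstep pi0 pi1 h v w * gpath pi0 pi1 (rcons h v) w ws'
  end.

(* P is the measure P_{v0}^{pi0,pi1} on runs of the game started at v0
   (characterised by its values on cylinders of finite run prefixes) *)
Definition is_game_measure (R : realType) (C U : finType) (pi0 : C -> U)
    (pi1 : seq (gvertex C U) -> C * U -> gvertex C U -> R)
    (v0 : gvertex C U)
    (P : probability (pathspace (gvertex C U) v0 setT) R) : Prop :=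
  forall (w0 : gvertex C U) (ws : seq (gvertex C U)),
    P [set w : runs (gvertex C U) v0 |
        w 0%N = w0 /\ forall k, (k < size ws)%N -> w k.+1 = nth w0 ws k]
    = (((w0 == v0) : nat)%:R * gpath pi0 pi1 [::] w0 ws)%:E.

Definition abs_prio d (S : measurableType d) (C U : finType) (Q : S -> C)
    (B : nat -> set S) (i : nat) : set (gvertex C U) :=
  [set v | exists c, v = gV0 c /\ Q @^-1` [set c] `<=` B i].

Definition refinement (S : Type) (C U : Type) (Q : S -> C) (pi0 : C -> U) :
  S -> U := fun s => pi0 (Q s).
Arguments abs_prio {d S C U} Q B i.

(* Main.v *)
(* Let W be the set of cells that a path of the CMP visits infinitely often.
   Almost surely the path only makes transitions allowed by Fup, and, by
   Borel-Cantelli, W is closed under Flo, since a cell in Flo c is entered from c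
   with probability bounded away from 0. The transitions made infinitely often
   connect all of W, and for such a transition from c to c' the set
   c' |: Flo c is a legal Player 1 move contained in W. If the path violated the
   parity condition, Player 1 would therefore have a winning answer to pi0: move
   uniformly at random until W is reached, and uniformly at random among the
   moves staying in W afterwards. With positive probability W is reached, and
   then the cell of W with the maximal, odd, priority is a.s. visited infinitely
   often, again by Borel-Cantelli. *)
Require Import Defs.
From HB Require Import structures.
From mathcomp Require Import all_boot all_order all_algebra.
From mathcomp Require Import all_classical all_reals all_analysis.
From mathcomp Require Import measurable_realfun.
Import Order.TTheory GRing.Theory Num.Theory.
Local Open Scope classical_set_scope.
Local Open Scope ring_scope.
Set Implicit Arguments.
Unset Strict Implicit.
Unset Printing Implicit Defensive.

(** * Measures on infinite runs from consistent cylinder weights *)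

(** The cumulative distribution function of [q] for the enumeration order of [D]. The values at
    [enum_rank d] and its successor bound the subinterval assigned to [d]. *)
Definition prefix_sum (R : realType) (D : finType) (q : D -> R) (k : nat) : R :=
  \sum_(e | (enum_rank e < k)%N) q e.

Lemma prefix_sumS (R : realType) (D : finType) (q : D -> R) (d : D) :
  prefix_sum q (enum_rank d).+1 = prefix_sum q (enum_rank d) + q d.
Proof.
rewrite /prefix_sum (bigD1 d) ?ltnSn//= addrC; congr (_ + _); apply: eq_bigl => e.
rewrite ltnS leq_eqVlt andb_orl andbC.
have -> : (enum_rank e == enum_rank d :> nat) = (e == d).
  by rewrite (inj_eq val_inj) (inj_eq enum_rank_inj).
by rewrite andNb/= andb_idr// => led; apply: contraTN led => /eqP ->; rewrite ltnn.
Qed.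

Lemma prefix_sum_le (R : realType) (D : finType) (q : D -> R) (k l : nat) :
  (forall d, 0 <= q d) -> (k <= l)%N -> prefix_sum q k <= prefix_sum q l.
Proof.
move=> q0 kl; rewrite /prefix_sum [leRHS](bigID (fun e => enum_rank e < k)%N)/=.
rewrite [X in _ <= X + _](eq_bigl (fun e => enum_rank e < k)%N).
  by rewrite lerDl sumr_ge0.
by move=> e; rewrite andb_idl// => /leq_trans; exact.
Qed.

Lemma prefix_sum0 (R : realType) (D : finType) (q : D -> R) : prefix_sum q 0 = 0.
Proof. exact: big_pred0. Qed.

Lemma prefix_sum_total (R : realType) (D : finType) (q : D -> R) :
  prefix_sum q #|D| = \sum_d q d.
Proof. by apply: eq_bigl => d; rewrite ltn_ord. Qed.

(** The least [k] whose prefix sum exceeds [y] is positive because [y] is nonnegative, and its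
    predecessor is the rank of the required [d]. *)
Lemma prefix_sum_cover (R : realType) (D : finType) (q : D -> R) (y : R) :
  (forall d, 0 <= q d) -> 0 <= y < \sum_d q d ->
  exists d : D, prefix_sum q (enum_rank d) <= y < prefix_sum q (enum_rank d).+1.
Proof.
move=> q0 /andP[y0 yD].
have ex : exists k, y < prefix_sum q k by exists #|D|; rewrite prefix_sum_total.
case: (ex_minnP ex) => -[|k]; first by rewrite prefix_sum0 ltNge y0.
move=> yk kmin; have kD : (k < #|D|)%N by apply: kmin; rewrite prefix_sum_total.
exists (enum_val (Ordinal kD)); rewrite enum_valK /= yk andbT leNgt.
by apply/negP => /kmin; rewrite ltnn.
Qed.

Lemma prefix_sum_disjoint (R : realType) (D : finType) (q : D -> R) (y : R) (d e : D) :
  (forall d, 0 <= q d) ->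
  prefix_sum q (enum_rank d) <= y < prefix_sum q (enum_rank d).+1 ->
  prefix_sum q (enum_rank e) <= y < prefix_sum q (enum_rank e).+1 -> d = e.
Proof.
move=> q0 /andP[dy yd] /andP[ey ye]; apply/enum_rank_inj/val_inj/eqP.
case: ltngtP => // [de|ed].
- by have := lt_le_trans yd (le_trans (prefix_sum_le q0 de) ey); rewrite ltxx.
- by have := lt_le_trans ye (le_trans (prefix_sum_le q0 ed) dy); rewrite ltxx.
Qed.

(* Each history h is represented by an interval of length p h, which is cut into
   consecutive intervals representing the histories rcons h d. A uniform point
   of [0, 1[ then determines a run with the right cylinder probabilities. *)
Definition leftpt (R : realType) (D : finType) (x0 : D) (p : seq D -> R)
    (h : seq D) : R :=
  \sum_(k < size h)
    prefix_sum (fun e => p (rcons (take k h) e)) (enum_rank (nth x0 h k)).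

Lemma leftpt_rcons (R : realType) (D : finType) (x0 : D) (p : seq D -> R) h d :
  leftpt x0 p (rcons h d) =
  leftpt x0 p h + prefix_sum (fun e => p (rcons h e)) (enum_rank d).
Proof.
rewrite /leftpt size_rcons big_ord_recr/= nth_rcons ltnn eqxx.
congr (_ + _); last by rewrite -cats1 take_size_cat.
apply: eq_bigr => -[k/= kh] _; rewrite nth_rcons kh.
by rewrite -cats1 takel_cat// ltnW.
Qed.

(** Half-open intervals, so that the cells of the children tile the cell of the parent without
    overlap. *)
Definition cell (R : realType) (D : finType) (x0 : D) (p : seq D -> R)
    (h : seq D) (x : R) : bool :=
  (leftpt x0 p h <= x < leftpt x0 p h + p h).

Lemma cell_rcons (R : realType) (D : finType) (x0 : D) (p : seq D -> R) h d x :
  cell x0 p (rcons h d) x =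
  (prefix_sum (fun e => p (rcons h e)) (enum_rank d) <= x - leftpt x0 p h
    < prefix_sum (fun e => p (rcons h e)) (enum_rank d).+1).
Proof.
by rewrite /cell leftpt_rcons prefix_sumS -addrA lerBrDl ltrBlDl.
Qed.

(** Descends the tree of nested intervals towards [x]. For consistent weights the default [x0] is
    used only when [x] lies outside [[0, 1[]. *)
Fixpoint cell_hist (R : realType) (D : finType) (x0 : D) (p : seq D -> R)
    (x : R) (n : nat) : seq D :=
  if n is n'.+1 then
    let h := cell_hist x0 p x n' in
    rcons h (odflt x0 [pick d | cell x0 p (rcons h d) x])
  else [::].

Definition cell_run (R : realType) (D : finType) (x0 : D) (p : seq D -> R)
    (x : R) (n : nat) : D :=
  last x0 (cell_hist x0 p x n.+1).

Lemma cell_hist_mkseq (R : realType) (D : finType) (x0 : D) (p : seq D -> R) x n :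
  cell_hist x0 p x n = mkseq (cell_run x0 p x) n.
Proof.
elim: n => //= n IH; rewrite [RHS]mkseqS -{}IH; congr rcons.
by rewrite /cell_run /= last_rcons.
Qed.

(** Kolmogorov consistency of a family of cylinder probabilities. *)
Definition tree_weight (R : realType) (D : finType) (p : seq D -> R) :=
  [/\ forall h, 0 <= p h, p [::] = 1 &
      forall h, \sum_d p (rcons h d) = p h].

(** A child cell lies inside its parent cell, so membership passes up to the root cell [[0, 1[].
    Siblings are disjoint, so the descent has no choice but to return [h]. *)
Lemma cell_hist_uniq (R : realType) (D : finType) (x0 : D) (p : seq D -> R) x h :
  tree_weight p -> cell x0 p h x ->
  0 <= x < 1 /\ cell_hist x0 p x (size h) = h.
Proof.
move=> [p0 p1 pS]; elim/last_ind: h => [|h d IH].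
  by rewrite /cell /leftpt big_ord0 p1 add0r => ->.
rewrite cell_rcons => hd.
have /IH[x01 {}IH] : cell x0 p h x.
  move: (hd) => /andP[h1 h2]; apply/andP; split.
    rewrite -subr_ge0 (le_trans _ h1)// -(prefix_sum0 (fun e => p (rcons h e))).
    exact: prefix_sum_le.
  rewrite -ltrBlDl (lt_le_trans h2)// -pS -prefix_sum_total prefix_sum_le//.
split=> //; rewrite size_rcons/= IH; congr rcons.
case: pickP => [e|/(_ d)]; last by rewrite cell_rcons hd.
by rewrite cell_rcons /= => he; apply: (prefix_sum_disjoint _ he hd).
Qed.

Lemma cell_hist_cell (R : realType) (D : finType) (x0 : D) (p : seq D -> R) x n :
  tree_weight p -> 0 <= x < 1 -> cell x0 p (cell_hist x0 p x n) x.
Proof.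
move=> [p0 p1 pS] x01; elim: n => [|n IH] /=.
  by rewrite /cell /leftpt big_ord0 p1 add0r.
case: pickP => [e //|/= no].
have [||d] := @prefix_sum_cover _ _ (fun e => p (rcons (cell_hist x0 p x n) e))
  (x - leftpt x0 p (cell_hist x0 p x n)).
- by [].
- by move: IH => /andP[h1 h2]; rewrite pS subr_ge0 h1 ltrBlDl h2.
by rewrite -cell_rcons no.
Qed.

Lemma cell_run_out (R : realType) (D : finType) (x0 : D) (p : seq D -> R) x n :
  tree_weight p -> ~~ (0 <= x < 1) -> cell_run x0 p x n = x0.
Proof.
move=> pw x01; rewrite /cell_run /= last_rcons; case: pickP => // d.
by move=> /(cell_hist_uniq pw)[]; rewrite (negbTE x01).
Qed.

Lemma cell_itv (R : realType) (D : finType) (x0 : D) (p : seq D -> R) h :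
  [set x | cell x0 p h x] = `[leftpt x0 p h, leftpt x0 p h + p h[%classic.
Proof. by apply/seteqP; split=> x /=; rewrite in_itv. Qed.

Lemma cell_run_cylinder (R : realType) (D : finType) (x0 : D) (p : seq D -> R) h :
  tree_weight p ->
  [set x | forall k, (k < size h)%N -> cell_run x0 p x k = nth x0 h k] `&`
    `[0, 1[%classic = [set x | cell x0 p h x].
Proof.
move=> pw; apply/seteqP; split=> x /=.
- rewrite in_itv/= => -[eq_h x01].
  have <- : cell_hist x0 p x (size h) = h; last exact: cell_hist_cell.
  rewrite cell_hist_mkseq; apply: (@eq_from_nth _ x0); rewrite size_mkseq// => k kh.
  by rewrite nth_mkseq// eq_h.
- move=> /(cell_hist_uniq pw)[x01 eq_h]; rewrite in_itv/=; split=> // k kh.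
  by rewrite -[in RHS]eq_h cell_hist_mkseq nth_mkseq.
Qed.

Lemma measurable_cell_run (R : realType) (D : finType) (x0 : D)
    (p : seq D -> R) : tree_weight p ->
  measurable_fun setT
    ((fun x => cell_run x0 p x) : measurableTypeR R -> pathspace D x0 setT).
Proof.
move=> pw.
have mc n d : measurable [set x : measurableTypeR R | cell_run x0 p x n = d].
  (* Inside [[0, 1[] the event is a finite union of intervals, one per history of length [n].
     Outside, the run is constantly [x0], which contributes only if [d] is [x0]. *)
  have -> : [set x : measurableTypeR R | cell_run x0 p x n = d] =
     (\bigcup_(h in [set: n.-tuple D]) [set x | cell x0 p (rcons h d) x]) `|`
     (if d == x0 then ~` `[0, 1[%classic else set0).
    apply/seteqP; split=> x /=.
      have [x01 <-|x01 <-] := boolP (0 <= x < 1).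
        left; have sz : size (mkseq (cell_run x0 p x) n) == n by rewrite size_mkseq.
        exists (Tuple sz) => //=.
        by rewrite -mkseqS -cell_hist_mkseq; exact: cell_hist_cell.
      by right; rewrite (cell_run_out x0 n pw x01) eqxx /= in_itv/=; exact/negP.
    move=> [[h _ /= /(cell_hist_uniq pw)[_]]|].
      rewrite size_rcons size_tuple /cell_run => ->; exact: last_rcons.
    case: eqP => // -> /=; rewrite in_itv/= => /negP; exact: cell_run_out.
  apply: measurableU; first apply: fin_bigcup_measurable.
  - exact: finite_finset.
  - by move=> h _; rewrite cell_itv; exact: measurable_itv.
  - by case: ifP => // _; apply: measurableC; exact: measurable_itv.
apply: (@measurability _ _ _ (pathspace D x0 setT) setT _ (cyl_gen D x0 setT) _) => //.
move=> _ [_ [n [A [_ ->]]] <-]; rewrite setTI.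
rewrite (_ : _ @^-1` _ = \bigcup_(d in A)
    [set x : measurableTypeR R | cell_run x0 p x n = d]).
  by apply: fin_bigcup_measurable => // *; exact: finite_finset.
by apply/seteqP; split=> x /= => [h|[d Ad ->]//]; exists (cell_run x0 p x n).
Qed.

(** The measure is the image under [cell_run] of Lebesgue measure restricted to [[0, 1[]: the
    preimage of a cylinder is an interval of length [p h]. *)
Lemma tree_measure (R : realType) (D : finType) (x0 : D) (p : seq D -> R) :
  tree_weight p ->
  exists P : probability (pathspace D x0 setT) R, forall h : seq D,
    P [set w : runs D x0 | forall k, (k < size h)%N -> w k = nth x0 h k]
    = (p h)%:E.
Proof.
move=> pw; have mf := @measurable_cell_run _ _ x0 _ pw.
pose f : {mfun (measurableTypeR R) >-> pathspace D x0 setT} := HB.pack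
  ((fun x => cell_run x0 p x) : measurableTypeR R -> pathspace D x0 setT)
  (isMeasurableFun.Build _ _ _ _ _ mf).
have mI : measurable (`[0, 1[%classic : set (measurableTypeR R)).
  exact: measurable_itv.
pose nu : {measure set (measurableTypeR R) -> \bar R} := mrestr lebesgue_measure mI.
have nu1 : nu setT = 1%E.
  by rewrite /nu/= /mrestr setTI lebesgue_measure_itv/= lte_fin ltr01 oppr0 adde0.
pose nuP : probability (measurableTypeR R) R := HB.pack (Measure.sort nu)
  (Measure_isProbability.Build _ _ _ nu nu1).
pose P : probability (pathspace D x0 setT) R := distribution nuP f.
exists P => h; rewrite /P/= /distribution /pushforward/= /nu/= /mrestr.
have := cell_run_cylinder x0 h pw; rewrite /preimage /= => ->.
rewrite cell_itv lebesgue_measure_itv/= lte_fin ltrDl.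
(* If [p h] is not positive it is zero, and the interval is empty. *)
have [p0 _ _] := pw; case: ltP => ph; first by rewrite -EFinD addrAC subrr add0r.
by congr _%:E; apply/eqP; rewrite eq_le p0 ph.
Qed.

(** * Recurrence by Borel-Cantelli *)

(* Let E n be the event that v is visited at time n and v' is not visited in
   [m, n[. The avoidance probability of v' drops by at least eps * P (E n) at
   step n, so P (E n) is summable and a.s. only finitely many E n occur. *)
Lemma visits_io (dO : measure_display) (Om : measurableType dO) (R : realType)
    (P : probability Om R) (D : finType) (X : nat -> Om -> D) (v v' : D)
    (eps : R) :
  (forall n d, measurable [set w | X n w = d]) -> 0 < eps ->
  (forall m n,
    eps%:E * P [set w | (forall k, (m <= k < n)%N -> X k w <> v') /\ X n w = v]
    <= P [set w | [/\ forall k, (m <= k < n)%N -> X k w <> v', X n w = v &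
                    X n.+1 w = v']])%E ->
  P.-negligible [set w | infinitely_often (fun n => X n w = v) /\
                        ~ infinitely_often (fun n => X n w = v')].
Proof.
move=> mX eps0 hX.
have [<-|vv'] := eqVneq v v'.
  rewrite (_ : [set w | _] = set0); first exact: negligible_set0.
  by apply/seteqP; split=> // w [].
pose A m n := [set w | forall k, (m <= k < n)%N -> X k w <> v'].
have mA m n : measurable (A m n).
  rewrite (_ : A m n = \bigcap_(k in [set k | (m <= k < n)%N]) ~` [set w | X k w = v']).
    by apply: bigcap_measurableType => k _; exact: measurableC.
  by apply/seteqP; split.
pose E m n := A m n `&` [set w | X n w = v].
have mE m n : measurable (E m n) by exact: measurableI.
(* Both events on the left avoid [v'] on [[m, n]], at time [n] because [v] differs from [v']. They
   are disjoint because the first one, after the bound [hX], visits [v'] at time [n.+1]. *)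
have step m i : (eps%:E * P (E m (m + i)%N) + P (A m (m + i).+2) <=
    P (A m (m + i).+1))%E.
  set n := (m + i)%N.
  have mF : measurable (E m n `&` [set w | X n.+1 w = v']) by exact: measurableI.
  apply: (@le_trans _ _ (P (E m n `&` [set w | X n.+1 w = v']) + P (A m n.+2))%E).
    rewrite leeD2r//; apply: (le_trans (hX m n)).
    rewrite (_ : [set w | and3 _ _ _] = E m n `&` [set w | X n.+1 w = v'])//.
    by apply/seteqP; split=> w /= [] => [? ? ?|[? ?] ?].
  rewrite -measureU//; last first.
    rewrite -subset0 => w [[_ /= Xv']] /(_ n.+1); apply=> //.
    by rewrite ltnS leqnn andbT leqW// leq_addr.
  apply: le_measure; rewrite ?inE//; first exact: measurableU.
  move=> w [[[/= Aw Xv] _]|/= Aw] k /andP[mk].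
    rewrite ltnS leq_eqVlt => /orP[/eqP ->|kn]; last by apply: Aw; rewrite mk.
    by rewrite Xv; exact/eqP.
  by move=> kn; apply: Aw; rewrite mk ltnW.
(* The drops telescope, and the avoidance probability starts at most at 1. *)
have sums m N : (\sum_(0 <= i < N) eps%:E * P (E m (m + i)%N) +
    P (A m (m + N).+1) <= 1)%E.
  elim: N => [|N IH]; first by rewrite big_nil add0e probability_le1.
  apply: le_trans IH; rewrite big_nat_recr//= -addeA leeD2l//.
  by rewrite addnS.
have null m : P (lim_sup_set (fun i => E m (m + i)%N)) = 0%E.
  apply: lim_sup_set_cvg0 => //.
  apply: (@le_lt_trans _ _ (eps^-1)%:E); last exact: ltry.
  apply: lime_le; first exact: is_cvg_nneseries.
  apply: nearW => N.
  rewrite -(@lee_pmul2l _ eps%:E) ?lte_fin// -EFinM mulfV ?gt_eqF//.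
  rewrite ge0_sume_distrr//; apply: le_trans (sums m N).
  by rewrite leeDl.
have : P.-negligible (\bigcup_m lim_sup_set (fun i => E m (m + i)%N)).
  apply: negligible_bigcup => m; apply/(negligibleP _ _).2; last exact: null.
  by apply: bigcapT_measurable => n; exact: bigcup_measurable.
(* If [v'] is avoided from time [m] on, every visit to [v] after [m] realises an event [E m n]. *)
move=> /(negligibleS _); apply=> w /= [iov].
rewrite /infinitely_often => /existsNP[m nov].
exists m => // k _; have [n [kn Xn]] := iov (m + k)%N.
have mn : (m <= n)%N by rewrite (leq_trans _ kn)// leq_addr.
exists (n - m)%N => /=; first by rewrite leq_subRL.
rewrite subnKC//; split=> //= j /andP[mj _] Xj.
by apply: nov; exists j.
Qed.

Lemma measurable_infinitely_often (dO : measure_display)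
    (Om : measurableType dO) (E : nat -> set Om) :
  (forall n, measurable (E n)) ->
  measurable [set w | infinitely_often (fun n => E n w)].
Proof.
move=> mE; rewrite (_ : [set _ | _] = lim_sup_set E).
  by apply: bigcapT_measurable => n; exact: bigcup_measurable.
apply/seteqP; split=> w /= io m.
  by move=> _; have [n [mn En]] := io m; exists n.
by have [n mn En] := io m I; exists n.
Qed.

Lemma measurable_parity_cond (dO : measure_display) (Om : measurableType dO)
    (X : Type) (ell : nat) (B : nat -> set X) (Y : Om -> nat -> X) :
  (forall i n, (1 <= i <= ell)%N -> measurable [set w | B i (Y w n)]) ->
  measurable [set w | parity_cond ell B (Y w)].
Proof.
move=> mB; pose IO i := [set w | infinitely_often (fun n => B i (Y w n))].
have mIO i : (1 <= i <= ell)%N -> measurable (IO i).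
  by move=> hi; apply: measurable_infinitely_often => n; exact: mB.
rewrite (_ : [set _ | _] =
  \bigcap_(i in [set i | (1 <= i <= ell)%N /\ odd i]) (~` IO i `|`
    \bigcup_(j in [set j | (i < j <= ell)%N /\ ~~ odd j]) IO j)).
  apply: bigcap_measurableType => i [hi _]; apply: measurableU.
    exact/measurableC/mIO.
  apply: bigcup_measurable => j [/andP[ij jl] _]; apply: mIO.
  by rewrite jl (leq_ltn_trans _ ij).
apply/seteqP; split=> w /= h i.
  move=> [hi oi]; have [ioi|nioi] := pselect (IO i w); last by left.
  by right; have [j [hj ej ioj]] := h i hi oi ioi; exists j.
move=> hi oi ioi; have [//|[j [hj ej] ioj]] := h i (conj hi oi).
by exists j.
Qed.

(** * The game under a memoryless Player 1 strategy *)

Lemma measurable_coord (X : Type) (x : X) (M : set (set X)) (A : set X) n :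
  M A -> measurable [set w : pathspace X x M | A (w n)].
Proof. by move=> MA; apply: sub_sigma_algebra; exists n, A. Qed.

(** Splitting by the finitely many histories of length [n] reduces events about the past to
    cylinders, whose probabilities are known. *)
Lemma prefix_event_sum (R : realType) (D : finType) (x0 : D)
    (P : probability (pathspace D x0 setT) R) (n : nat) (A : set (seq D))
    (t : seq D) :
  P [set w : runs D x0 | A (mkseq w n) /\
       forall k, (k < size t)%N -> w (n + k)%N = nth x0 t k] =
  (\sum_(h \in [set h : n.-tuple D | A h])
     P [set w : runs D x0 | forall k, (k < size (h ++ t))%N ->
          w k = nth x0 (h ++ t) k])%E.
Proof.
rewrite -measure_fin_bigcup.
- congr (P _); apply/seteqP; split=> w /=.
    move=> [Aw wt]; have sz : size (mkseq w n) == n by rewrite size_mkseq.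
    exists (Tuple sz) => //= k; rewrite size_cat size_mkseq nth_cat size_mkseq.
    case: (ltnP k n) => [kn _|nk kt]; first by rewrite nth_mkseq.
    by rewrite -wt ?subnKC// ltn_subLR.
  move=> [h Ah /= wh]; have eh : mkseq w n = h.
    apply: (@eq_from_nth _ x0); rewrite size_mkseq ?size_tuple// => k kn.
    by rewrite nth_mkseq// wh ?nth_cat ?size_cat size_tuple ?kn// ltn_addr.
  split; first by rewrite eh.
  move=> k kt; rewrite wh ?size_cat ?size_tuple ?ltn_add2l//.
  by rewrite nth_cat size_tuple ltnNge leq_addr/= addKn.
- exact: finite_finset.
- apply/trivIsetP => h h' _ _ /eqP hh'; rewrite -subset0 => w [/= wh wh'].
  apply: hh'; apply: val_inj; apply: (@eq_from_nth _ x0); rewrite !size_tuple// => k kn.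
  have := wh k; have := wh' k; rewrite !nth_cat !size_cat !size_tuple kn.
  by rewrite ltn_addr// => <-// ->.
- move=> h _; rewrite [X in measurable X](_ : _ =
    \bigcap_(k in [set k | (k < size (h ++ t))%N])
      [set w : runs D x0 | [set nth x0 (h ++ t) k] (w k)]).
    by apply: bigcap_measurableType => k _; exact: measurable_coord.
  by apply/seteqP; split.
Qed.

(** The Markov property: the factor [q] is the same for every history ending in [v], so it comes out
    of the sum over histories. *)
Lemma next_step_prob (R : realType) (D : finType) (x0 : D)
    (P : probability (pathspace D x0 setT) R) (p : seq D -> R) (q : R)
    (v v' : D) (n : nat) (A : set (seq D)) :
  (forall h : seq D,
    P [set w : runs D x0 | forall k, (k < size h)%N -> w k = nth x0 h k]
    = (p h)%:E) ->
  (forall h, p (rcons (rcons h v) v') = q * p (rcons h v)) ->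
  P [set w : runs D x0 | [/\ A (mkseq w n), w n = v & w n.+1 = v']] =
  (q%:E * P [set w : runs D x0 | A (mkseq w n) /\ w n = v])%E.
Proof.
move=> hP hp.
rewrite (_ : [set w | [/\ _, _ & _]] = [set w : runs D x0 | A (mkseq w n) /\
    forall k, (k < size [:: v; v'])%N -> w (n + k)%N = nth x0 [:: v; v'] k]); last first.
  apply/seteqP; split=> w /=.
    by move=> [? ? ?]; split=> // -[|[|]]//; rewrite ?addn0 ?addn1.
  by move=> [? h]; split=> //; [have := h 0 isT|have := h 1 isT];
    rewrite ?addn0 ?addn1.
rewrite (_ : [set w | A _ /\ _ = _] = [set w : runs D x0 | A (mkseq w n) /\
    forall k, (k < size [:: v])%N -> w (n + k)%N = nth x0 [:: v] k]); last first.
  apply/seteqP; split=> w /=.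
    by move=> [? ?]; split=> // -[|[|]]//; rewrite ?addn0 ?addn1.
  by move=> [? h]; split=> //; have := h 0 isT; rewrite ?addn0.
rewrite !prefix_event_sum ge0_mule_fsumr//; apply: eq_fsbigr => h _.
by rewrite !hP -EFinM cats1 -cat_rcons cats1 hp.
Qed.

(** [gpath] unfolds from the front and records the history. As [sigma] ignores the history, the last
    step can be split off instead. *)
Lemma gpath_rcons (R : realType) (C U : finType) (pi0 : C -> U)
    (sigma : C * U -> gvertex C U -> R) h v ws w :
  gpath pi0 (fun=> sigma) h v (rcons ws w) =
  gpath pi0 (fun=> sigma) h v ws * gstep pi0 (fun=> sigma) [::] (last v ws) w.
Proof.
elim: ws h v => [|x ws IH] h v /=; first by rewrite mul1r mulr1; case: v => [[]|].
by rewrite IH mulrA.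
Qed.

Definition run_weight (R : realType) (C U : finType) (pi0 : C -> U)
    (sigma : C * U -> gvertex C U -> R) (v0 : gvertex C U)
    (h : seq (gvertex C U)) : R :=
  if h is w0 :: ws then
    ((w0 == v0) : nat)%:R * gpath pi0 (fun=> sigma) [::] w0 ws
  else 1.

Lemma run_weight_rcons2 (R : realType) (C U : finType) (pi0 : C -> U)
    (sigma : C * U -> gvertex C U -> R) v0 h v v' :
  run_weight pi0 sigma v0 (rcons (rcons h v) v') =
  gstep pi0 (fun=> sigma) [::] v v' * run_weight pi0 sigma v0 (rcons h v).
Proof.
case: h => [|w0 h] /=; first by rewrite !mulr1 mulrC.
by rewrite gpath_rcons last_rcons mulrA mulrC.
Qed.

Lemma gstep_ge0 (R : realType) (C U : finType) (Fup Flo : C -> U -> {set C})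
    (pi0 : C -> U) (sigma : C * U -> gvertex C U -> R) v v' :
  p1_strategy Fup Flo (fun=> sigma) -> 0 <= gstep pi0 (fun=> sigma) [::] v v'.
Proof.
move=> [s0 _ _]; case: v => [[c|cu]|r] //=; first exact: (s0 [::]).
by case: v' => [[c|//]|//]; rewrite divr_ge0.
Qed.

Lemma gstep_emptyset (R : realType) (C U : finType) (Fup Flo : C -> U -> {set C})
    (pi0 : C -> U) (sigma : C * U -> gvertex C U -> R) v :
  p1_strategy Fup Flo (fun=> sigma) ->
  gstep pi0 (fun=> sigma) [::] v (gVr finset.set0) = 0.
Proof.
move=> [_ _ sE]; case: v => [[c|[c u]]|r] //=.
apply/eqP; apply: contraT => /(sE [::]) /=.
by rewrite /Vr_of cards0 /= !andbF.
Qed.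

Lemma gstep_sum (R : realType) (C U : finType) (Fup Flo : C -> U -> {set C})
    (pi0 : C -> U) (sigma : C * U -> gvertex C U -> R) v :
  p1_strategy Fup Flo (fun=> sigma) -> v != gVr finset.set0 ->
  \sum_v' gstep pi0 (fun=> sigma) [::] v v' = 1.
Proof.
move=> [_ s1 _]; case: v => [[c|cu]|r] /= rne; last first.
- rewrite 2!big_sumType/= [X in _ + X]big1// addr0 [X in _ + X]big1// addr0.
  rewrite -mulr_suml -natr_sum -big_mkcond/= sum1_card divff// pnatr_eq0 cards_eq0.
  by apply: contra rne => /eqP ->.
- exact: (s1 [::]).
- rewrite (bigD1 (gV1 c (pi0 c)))//= eqxx big1 ?addr0// => v' /negbTE.
  by rewrite /gV1 => ->.
Qed.

Lemma run_weight_tree (R : realType) (C U : finType)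
    (Fup Flo : C -> U -> {set C}) (pi0 : C -> U)
    (sigma : C * U -> gvertex C U -> R) (c0 : C) :
  p1_strategy Fup Flo (fun=> sigma) ->
  tree_weight (run_weight pi0 sigma (gV0 c0)).
Proof.
move=> st; set p := run_weight _ _ _; split=> //.
- elim/last_ind => [//|h v IH]; rewrite /p; case/lastP: h IH => [_|h u IH].
    by rewrite /= mulr1.
  by rewrite run_weight_rcons2 mulr_ge0// (gstep_ge0 _ _ _ st).
- elim/last_ind => [|h v _].
    rewrite /p /= (bigD1 (gV0 c0))//= eqxx mulr1 big1 ?addr0// => v /negbTE ->.
    by rewrite mul0r.
  rewrite /p; under eq_bigr do rewrite run_weight_rcons2.
  (* The empty random vertex has no successor, so its steps sum to 0 instead of 1. Consistency
     survives because no step enters it and it is not the initial vertex, so histories ending there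
     already have weight 0. *)
  rewrite -mulr_suml; have [->|vne] := eqVneq v (gVr finset.set0); last first.
    by rewrite (gstep_sum _ st vne) mul1r.
  case/lastP: h => [|h u]; first by rewrite /= mul0r mulr0.
  by rewrite run_weight_rcons2 (gstep_emptyset _ _ st) mul0r mulr0.
Qed.

Lemma game_measure_cylinder (R : realType) (C U : finType) (pi0 : C -> U)
    (sigma : C * U -> gvertex C U -> R) (v0 : gvertex C U)
    (P : probability (pathspace (gvertex C U) v0 setT) R) :
  is_game_measure pi0 (fun=> sigma) P <->
  forall h, P [set w : runs (gvertex C U) v0 |
     forall k, (k < size h)%N -> w k = nth v0 h k]
  = (run_weight pi0 sigma v0 h)%:E.
Proof.
have cylE w0 ws : [set w : runs (gvertex C U) v0 |
    forall k, (k < size (w0 :: ws))%N -> w k = nth v0 (w0 :: ws) k] =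
    [set w : runs (gvertex C U) v0 |
    w 0%N = w0 /\ forall k, (k < size ws)%N -> w k.+1 = nth w0 ws k].
  apply/seteqP; split=> w /=.
    move=> h; split=> [|k kws]; first exact: (h 0).
    by rewrite (h k.+1)//= (set_nth_default w0).
  move=> [h0 hS] [|k]//=; rewrite ltnS => kws.
  by rewrite hS// (set_nth_default v0).
split=> [gP [|w0 ws]|cP w0 ws]; last by rewrite -cylE cP.
  rewrite [X in P X](_ : _ = setT) ?probability_setT//.
  by apply/seteqP; split.
by rewrite cylE gP.
Qed.

Lemma game_measure_exists (R : realType) (C U : finType)
    (Fup Flo : C -> U -> {set C}) (pi0 : C -> U)
    (sigma : C * U -> gvertex C U -> R) (c0 : C) :
  p1_strategy Fup Flo (fun=> sigma) ->
  exists P : probability (pathspace (gvertex C U) (gV0 c0) setT) R,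
    is_game_measure pi0 (fun=> sigma) P.
Proof.
move=> st; have [P hP] := tree_measure (gV0 c0) (run_weight_tree pi0 c0 st).
by exists P; apply/game_measure_cylinder.
Qed.

Lemma negligible_exists d (Om : measurableType d) (R : realType)
    (mu : {measure set Om -> \bar R}) (I : countType) (F : I -> set Om) :
  (forall i, mu.-negligible (F i)) -> mu.-negligible [set w | exists i, F i w].
Proof.
move=> nF; have : mu.-negligible (\bigcup_n oapp F set0 (unpickle n)).
  apply: negligible_bigcup => n; case: unpickle => [i|] //=.
  exact: negligible_set0.
by move=> /(negligibleS _); apply=> w /= [i Fi]; exists (pickle i); rewrite ?pickleK.
Qed.

(** A union over the countably many triples of a time and two vertices, each null by the Markov
    property. *)
Lemma game_steps_ae (R : realType) (C U : finType) (pi0 : C -> U)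
    (sigma : C * U -> gvertex C U -> R) (v0 : gvertex C U)
    (P : probability (pathspace (gvertex C U) v0 setT) R) :
  is_game_measure pi0 (fun=> sigma) P ->
  P.-negligible [set w : runs (gvertex C U) v0 |
     exists n, gstep pi0 (fun=> sigma) [::] (w n) (w n.+1) = 0].
Proof.
move=> /game_measure_cylinder gP.
have : P.-negligible [set w : runs (gvertex C U) v0 |
    exists nvv : nat * gvertex C U * gvertex C U,
    let: (n, v, v') := nvv in
    [/\ w n = v, w n.+1 = v' & gstep pi0 (fun=> sigma) [::] v v' = 0]].
  apply: negligible_exists => -[[n v] v'].
  have [e0|e0] := eqVneq (gstep pi0 (fun=> sigma) [::] v v') 0; last first.
    rewrite [X in _.-negligible X](_ : _ = set0); first exact: negligible_set0.
    by apply/seteqP; split=> // w [_ _] /eqP; rewrite (negbTE e0).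
  rewrite [X in _.-negligible X](_ : _ = [set w : runs (gvertex C U) v0 |
    [/\ [set: seq (gvertex C U)] (mkseq w n), w n = v & w n.+1 = v']]); last first.
    by apply/seteqP; split=> w [].
  apply/(negligibleP _ _).2.
    rewrite [X in measurable X](_ : _ = [set w : runs (gvertex C U) v0 | [set v] (w n)]
      `&` [set w | [set v'] (w n.+1)]).
      by apply: measurableI; exact: measurable_coord.
    by apply/seteqP; split=> w [].
  have := next_step_prob n [set: seq (gvertex C U)] gP
    (fun h => run_weight_rcons2 pi0 sigma v0 h v v').
  by rewrite e0 mul0e.
move=> /(negligibleS _); apply=> w /= [n wn].
by exists (n, w n, w n.+1).
Qed.

(** There are finitely many pairs of vertices, and for each one [visits_io] applies with the
    one-step probability itself as [eps]. *)
Lemma game_visits_ae (R : realType) (C U : finType) (pi0 : C -> U)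
    (Fup Flo : C -> U -> {set C})
    (sigma : C * U -> gvertex C U -> R) (v0 : gvertex C U)
    (P : probability (pathspace (gvertex C U) v0 setT) R) :
  p1_strategy Fup Flo (fun=> sigma) ->
  is_game_measure pi0 (fun=> sigma) P ->
  P.-negligible [set w : runs (gvertex C U) v0 |
     exists vv : gvertex C U * gvertex C U,
     [/\ gstep pi0 (fun=> sigma) [::] vv.1 vv.2 != 0,
        infinitely_often (fun n => w n = vv.1) &
        ~ infinitely_often (fun n => w n = vv.2)]].
Proof.
move=> st /game_measure_cylinder gP.
apply: negligible_exists => -[v v'] /=.
have [e0|e0] := eqVneq (gstep pi0 (fun=> sigma) [::] v v') 0.
  rewrite [X in _.-negligible X](_ : _ = set0); first exact: negligible_set0.
  by apply/seteqP; split=> // w [].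
have : P.-negligible [set w : runs (gvertex C U) v0 |
    infinitely_often (fun n => w n = v) /\ ~ infinitely_often (fun n => w n = v')].
  apply: (@visits_io _ _ _ P _ (fun n (w : runs _ v0) => w n) v v'
    (gstep pi0 (fun=> sigma) [::] v v')).
  - by move=> n d; exact: (measurable_coord (A := [set d])).
  - by rewrite lt_def e0 (gstep_ge0 _ _ _ st).
  move=> m n; pose A (h : seq (gvertex C U)) :=
    forall k, (m <= k < n)%N -> nth v0 h k <> v'.
  have AE w : A (mkseq w n) = forall k, (m <= k < n)%N -> w k <> v'.
    apply/propext; split=> h k /andP[mk kn]; have := h k;
      by rewrite nth_mkseq// mk kn; exact.
  have := next_step_prob n A gP (fun h => run_weight_rcons2 pi0 sigma v0 h v v').
  by under eq_set do rewrite AE; under [in RHS]eq_set do rewrite AE; move=> ->.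
by move=> /(negligibleS _); apply=> w /= [].
Qed.

(** * Components that Player 1 can trap the game in *)

Lemma infinitely_often_pigeonhole (D : finType) (w : nat -> D)
    (E : nat -> Prop) :
  infinitely_often E -> exists v, infinitely_often (fun n => E n /\ w n = v).
Proof.
move=> ioE; apply: contrapT => /forallNP no.
have /choice[f hf] : forall v, exists m, forall n, (m <= n)%N -> E n -> w n <> v.
  move=> v; have /existsNP[m hm] := no v; exists m => n mn En wn.
  by apply: hm; exists n.
have [n [fn En]] := ioE (\max_v f v)%N.
by apply: (hf (w n) n _ En) => //; apply: leq_trans fn; exact: leq_bigmax.
Qed.

(* Player 1 is only confined to W at the vertices (c, pi0 c): for other inputs u
   there may be no legal move inside W. *)
Definition allowed (C U : finType) (Fup Flo : C -> U -> {set C}) (pi0 : C -> U)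
    (W : {set C}) (c : C) (u : U) : {set {set C}} :=
  [set r | Vr_of Fup Flo c u r
           & (c \in W) && (u == pi0 c) ==> (r \subset W)].

(** The uniform distribution on [allowed]. One memoryless strategy serves both before and after [W]
    is reached, as [allowed] is confined to [W] only at cells of [W]. *)
Definition stay_in (R : realType) (C U : finType) (Fup Flo : C -> U -> {set C})
    (pi0 : C -> U) (W : {set C}) (cu : C * U) (v : gvertex C U) : R :=
  if v is inr r then
    let A := allowed Fup Flo pi0 W cu.1 cu.2 in
    ((r \in A) : nat)%:R / #|A|%:R
  else 0.

Definition inside (C U : finType) (pi0 : C -> U) (W : {set C})
    (v : gvertex C U) : bool :=
  match v with
  | inl (inl c) => c \in W
  | inl (inr (c, u)) => (c \in W) && (u == pi0 c)
  | inr r => r \subset W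
  end.

(** The bound [#|Flo c u| + 1] on the size of a move leaves room for exactly one extra cell, here
    [c']. *)
Lemma allowed_succ (C U : finType) (Fup Flo : C -> U -> {set C}) (pi0 : C -> U)
    (W : {set C}) c u c' :
  Flo c u \subset Fup c u -> c' \in Fup c u ->
  ((c \in W) -> u = pi0 c -> Flo c u \subset W /\ c' \in W) ->
  c' |: Flo c u \in allowed Fup Flo pi0 W c u.
Proof.
move=> lo_up upc' hW; rewrite !inE /Vr_of finset.subsetUr/=.
rewrite finset.subUset finset.sub1set upc' lo_up/=.
apply/andP; split.
  apply/andP; split.
    by rewrite card_gt0; apply/set0Pn; exists c'; rewrite !inE eqxx.
  by rewrite cardsU1 addnC leq_add2l leq_b1.
apply/implyP => /andP[cW /eqP uc]; have [loW c'W] := hW cW uc.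
by rewrite finset.subUset finset.sub1set c'W.
Qed.

(** The uniform distribution needs a nonempty set of moves. The extra cell of the move is taken in
    [W] where Player 1 is confined, and anywhere in [Fup c u] otherwise. *)
Lemma stay_in_strategy (R : realType) (C U : finType)
    (Fup Flo : C -> U -> {set C}) (pi0 : C -> U) (W : {set C}) :
  (forall c u, Flo c u \subset Fup c u) ->
  (forall c u, exists c', c' \in Fup c u) ->
  (forall c, c \in W -> Flo c (pi0 c) \subset W) ->
  (forall c, c \in W -> exists2 c', c' \in W & c' \in Fup c (pi0 c)) ->
  p1_strategy Fup Flo (fun=> @stay_in R C U Fup Flo pi0 W).
Proof.
move=> lo_up up_ne loW upW.
have A0 c u : (0 < #|allowed Fup Flo pi0 W c u|)%N.
  rewrite card_gt0; apply/set0Pn.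
  have [/andP[cW /eqP ->]|ncu] := boolP ((c \in W) && (u == pi0 c)).
    have [c' c'W c'F] := upW c cW.
    by exists (c' |: Flo c (pi0 c)); apply: allowed_succ => // _ _; rewrite loW.
  have [c' c'F] := up_ne c u.
  exists (c' |: Flo c u); apply: allowed_succ => // cW uc.
  by rewrite cW uc eqxx in ncu.
split.
- by move=> _ [c u] [//|r] /=; rewrite divr_ge0.
- move=> _ [c u]; rewrite big_sumType/= big1// add0r.
  rewrite -mulr_suml -natr_sum -big_mkcond/= sum1_card divff// pnatr_eq0.
  by rewrite -lt0n.
- move=> _ [c u] [|r] /=; first by rewrite eqxx.
  by rewrite inE; case: Vr_of => //=; rewrite mul0r eqxx.
Qed.

Lemma gstep_inside (R : realType) (C U : finType)
    (Fup Flo : C -> U -> {set C}) (pi0 : C -> U) (W : {set C}) v v' :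
  gstep pi0 (fun=> @stay_in R C U Fup Flo pi0 W) [::] v v' != 0 ->
  inside pi0 W v -> inside pi0 W v'.
Proof.
case: v => [[c|[c u]]|r] /=.
- by case: (eqVneq v' (gV1 c (pi0 c))) => [-> _ /=|_]; rewrite ?eqxx ?andbT.
- case: v' => [|r] /=; first by rewrite eqxx.
  rewrite inE => h /andP[cW uc]; move: h; rewrite cW uc /=.
  by case: (r \subset W) => //; rewrite andbF mul0r eqxx.
- case: v' => [[c|]|] /=; rewrite ?eqxx//.
  by case: (boolP (c \in r)) => [cr _ /fintype.subsetP|]; [exact|rewrite mul0r eqxx].
Qed.

(** Play cycles through the three kinds of vertices, so one of any three consecutive vertices is a
    cell. *)
Lemma gstep_kind (R : realType) (C U : finType)
    (Fup Flo : C -> U -> {set C}) (pi0 : C -> U)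
    (sigma : C * U -> gvertex C U -> R) v v' :
  p1_strategy Fup Flo (fun=> sigma) ->
  gstep pi0 (fun=> sigma) [::] v v' != 0 ->
  match v, v' with
  | inl (inl _), inl (inr _) | inl (inr _), inr _ | inr _, inl (inl _) => true
  | _, _ => false
  end.
Proof.
move=> [_ _ sE]; case: v => [[c|[c u]]|r] /=.
- by case: (eqVneq v' (gV1 c (pi0 c))) => [-> //|_]; rewrite eqxx.
- by move=> /(sE [::]); case: v'.
- by case: v' => [[c|]|] //=; rewrite eqxx.
Qed.

Lemma gstep_history (R : realType) (C U : finType) (pi0 : C -> U)
    (sigma : C * U -> gvertex C U -> R) h v v' :
  gstep pi0 (fun=> sigma) h v v' = gstep pi0 (fun=> sigma) [::] v v'.
Proof. by case: v => [[]|]. Qed.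

(** Simulates one transition from [c] to [c'] of the abstract process by three game steps of
    positive probability. *)
Lemma gstep_three_stages (R : realType) (C U : finType)
    (Fup Flo : C -> U -> {set C}) (pi0 : C -> U) (W : {set C}) (c c' : C) :
  let step := gstep pi0 (fun=> @stay_in R C U Fup Flo pi0 W) [::] in
  Flo c (pi0 c) \subset Fup c (pi0 c) -> c' \in Fup c (pi0 c) ->
  (c \in W -> Flo c (pi0 c) \subset W /\ c' \in W) ->
  let r := c' |: Flo c (pi0 c) in
  [/\ step (gV0 c) (gV1 c (pi0 c)) != 0, step (gV1 c (pi0 c)) (gVr r) != 0 &
      step (gVr r) (gV0 c') != 0].
Proof.
move=> step lo_up upc' hW r.
have rA : r \in allowed Fup Flo pi0 W c (pi0 c) by apply: allowed_succ => // /hW.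
split; rewrite /step /=.
- by rewrite eqxx oner_neq0.
- rewrite rA mul1r invr_eq0 pnatr_eq0 -lt0n card_gt0.
  by apply/set0Pn; exists r.
- rewrite /r !inE eqxx mul1r invr_eq0 pnatr_eq0 -lt0n card_gt0.
  by apply/set0Pn; exists c'; rewrite !inE eqxx.
Qed.

(** The path is followed only until its first cell in [W]. Before that Player 1 is unconfined, so
    each transition along [Fup] can be simulated. *)
Lemma reach_inside (R : realType) (C U : finType)
    (Fup Flo : C -> U -> {set C}) (pi0 : C -> U) (W : {set C}) (c : C)
    (p : seq C) (h : seq (gvertex C U)) :
  (forall c u, Flo c u \subset Fup c u) ->
  path (fun c c' => c' \in Fup c (pi0 c)) c p -> last c p \in W ->
  exists ws, gpath pi0 (fun=> @stay_in R C U Fup Flo pi0 W) h (gV0 c) ws != 0 /\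
    inside pi0 W (last (gV0 c) ws).
Proof.
move=> lo_up; elim: p c h => [|c1 p IH] c h /=.
  by move=> _ cW; exists [::]; rewrite /= oner_neq0.
move=> /andP[cc1 pth] lW; have [cW|cW] := boolP (c \in W).
  by exists [::]; rewrite /= oner_neq0.
have [//|//|//|s1 s2 s3] := @gstep_three_stages R C U Fup Flo pi0 W c c1.
  by rewrite (negbTE cW).
set r := c1 |: _ in s2 s3.
have [ws [gws iws]] :=
  IH c1 (rcons (rcons (rcons h (gV0 c)) (gV1 c (pi0 c))) (gVr r)) pth lW.
exists [:: gV1 c (pi0 c), gVr r, gV0 c1 & ws]; split=> //.
exact: mulf_neq0 s1 (mulf_neq0 s2 (mulf_neq0 s3 gws)).
Qed.

(** Against [stay_in], a finite prefix [ws] of positive weight leads into [W]. Almost every run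
    extending it stays in [W] and visits [ctop] infinitely often, which violates the parity
    condition that [pi0] ensures. *)
Lemma no_losing_component (R : realType) (d : measure_display)
    (S : measurableType d) (C U : finType) (Q : S -> C)
    (ell : nat) (B : nat -> set S)
    (Fup Flo : C -> U -> {set C}) (pi0 : C -> U) (shat : C)
    (W : {set C}) (cW ctop : C) (i : nat) :
  (forall c u, Flo c u \subset Fup c u) ->
  (forall c u, exists c', c' \in Fup c u) ->
  (forall pi1 : seq (gvertex C U) -> C * U -> gvertex C U -> R,
    p1_strategy Fup Flo pi1 ->
    forall P : probability (pathspace (gvertex C U) (gV0 shat) setT) R,
      is_game_measure pi0 pi1 P ->
      P [set w : runs (gvertex C U) (gV0 shat) |
          parity_cond ell (abs_prio (C:=C) (U:=U) Q B) w] = 1%E) ->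
  cW \in W -> connect (fun c c' => c' \in Fup c (pi0 c)) shat cW ->
  (forall c, c \in W -> Flo c (pi0 c) \subset W) ->
  (forall c, c \in W -> exists2 c', c' \in W & c' \in Fup c (pi0 c)) ->
  (forall c, c \in W ->
    connect (fun c c' => (c' \in W) && (c' \in Fup c (pi0 c))) c ctop) ->
  (1 <= i <= ell)%N -> odd i -> Q @^-1` [set ctop] `<=` B i ->
  (forall j c, (i < j <= ell)%N -> ~~ odd j -> c \in W ->
    ~ Q @^-1` [set c] `<=` B j) ->
  False.
Proof.
move=> lo_up up_ne hwin cWW /connectP[p pth cWE] loW upW conW hi oi topB noB.
have st := @stay_in_strategy R C U Fup Flo pi0 W lo_up up_ne loW upW.
set sigma := stay_in _ _ _ _ _ in st.
pose step := gstep pi0 (fun=> sigma) [::].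
have [P gP] := game_measure_exists pi0 shat st.
have [ws [gws iws]] : exists ws, gpath pi0 (fun=> sigma) [::] (gV0 shat) ws != 0 /\
    inside pi0 W (last (gV0 shat) ws).
  by apply: (@reach_inside _ _ _ _ _ _ _ _ p) => //; rewrite -cWE.
pose par : set (pathspace (gvertex C U) (gV0 shat) setT) :=
  [set w | parity_cond ell (abs_prio (C:=C) (U:=U) Q B) w].
have P1 : P par = 1%E := hwin _ st P gP.
have mpar : measurable par.
  by apply: measurable_parity_cond => j n _; exact: measurable_coord.
have Npar : P.-negligible (~` par).
  apply/(negligibleP _ _).2; first exact: measurableC.
  by have := probability_setC P mpar; rewrite P1 subee.
have N := negligibleU (negligibleU (game_steps_ae gP) (game_visits_ae st gP)) Npar.
pose cyl : set (pathspace (gvertex C U) (gV0 shat) setT) :=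
  [set w | w 0%N = gV0 shat /\
           forall k, (k < size ws)%N -> w k.+1 = nth (gV0 shat) ws k].
have Pcyl : P cyl = _ := gP (gV0 shat) ws.
have mcyl : measurable cyl.
  rewrite [X in measurable X](_ : _ =
    [set w : runs _ (gV0 shat) | [set gV0 shat] (w 0%N)] `&`
    \bigcap_(k in [set k | (k < size ws)%N])
      [set w : runs _ (gV0 shat) | [set nth (gV0 shat) ws k] (w k.+1)]).
    apply: measurableI; first exact: measurable_coord.
    by apply: bigcap_measurableType => k _; exact: measurable_coord.
  by apply/seteqP; split.
(* A run in the cylinder that avoids all three null sets gives a contradiction, so the cylinder is
   null, although its weight is nonzero. *)
have : P cyl = 0%E.
  apply/(negligibleP _ mcyl).1/(negligibleS _ N) => w [w0 wS].
  apply: contrapT => /not_orP[/not_orP[/forallNP N1 /forallNP N2]] /contrapT pw.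
  have stepw n : step (w n) (w n.+1) != 0 by apply/eqP/N1.
  have iov v v' : step v v' != 0 -> infinitely_often (fun n => w n = v) ->
      infinitely_often (fun n => w n = v').
    by move=> sv io; apply: contrapT => nio; apply: (N2 (v, v')).
  have insw n : (size ws <= n)%N -> inside pi0 W (w n).
    move=> /subnKC <-; elim: (n - _)%N => [|k IH].
      rewrite addn0; suff -> : w (size ws) = last (gV0 shat) ws by [].
      by case: (ws) wS => [//|x ws' wS]; rewrite /= wS// (last_nth (gV0 shat)).
    by rewrite addnS; apply: gstep_inside (stepw _) IH.
  (* The pigeonhole principle is applied to the always true event, to find some recurrent vertex. *)
  have [v iov0] := infinitely_often_pigeonhole w
    (fun m => ex_intro (fun n => (m <= n)%N /\ True) m (conj (leqnn m) I)).
  have [n [nws [_ wn]]] := iov0 (size ws).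
  (* Recurrence propagates along the steps of the run itself, as they all have positive
     probability. *)
  have ioall k : infinitely_often (fun m => w m = w (n + k)%N).
    elim: k => [|k IH]; last by apply: iov IH; rewrite addnS; exact: stepw.
    rewrite addn0 wn => m; have [n' [mn' [_ wn']]] := iov0 m.
    by exists n'.
  have [k [c wk]] : exists k c, w (n + k)%N = gV0 c.
    have := gstep_kind st (stepw n); have := gstep_kind st (stepw n.+1).
    case w0E : (w n) => [[c|cu]|r]; first by move=> _ _; exists 0%N, c; rewrite addn0.
      case: (w n.+1) => [//|r]; case w2E : (w n.+2) => [[c|//]|//] _ _.
      by exists 2%N, c; rewrite addn2.
    case w1E : (w n.+1) => [[c|//]|//] _ _.
    by exists 1%N, c; rewrite addn1.
  have cinW : c \in W.
    have := insw (n + k)%N; rewrite wk; apply.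
    by rewrite (leq_trans nws)// leq_addr.
  (* Recurrence propagates from [c] along a path inside [W], with three game steps per edge. *)
  have iotop : infinitely_often (fun n => w n = gV0 ctop).
    have /connectP[q] := conW c cinW; have := ioall k; rewrite wk.
    elim: q (c) cinW => [|c1 q IH] c2 c2W ioc2 /=; first by move=> _ ->.
    move=> /andP[/andP[c1W c1up] pq] e; apply: (IH c1) => //.
    have [//|//|_|s1 s2 s3] := @gstep_three_stages R C U Fup Flo pi0 W c2 c1.
      by rewrite loW.
    exact: iov s3 (iov _ _ s2 (iov _ _ s1 ioc2)).
  have [|j [hj ej ioj]] := pw i hi oi.
    move=> m; have [n' [mn' wn']] := iotop m.
    by exists n'; split=> //; exists ctop.
  (* A visit after the prefix [ws] takes place inside [W], where [noB] excludes the priority [j]. *)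
  have [n' [nws' [c' [wn' Bc']]]] := ioj (size ws).
  by apply: (noB j c' hj ej _ Bc'); have := insw n' nws'; rewrite wn'.
rewrite Pcyl eqxx mul1r => -[] /eqP; exact/negP.
Qed.

(** * Paths of the CMP *)

Lemma cylF_ge0 d (S : measurableType d) (R : realType) (U : Type)
    (T : S -> U -> probability S R) (rho : S -> U) (As : seq (set S)) s :
  (0 <= cylF T rho As s)%E.
Proof.
elim: As s => [//|A As IH] s /=.
by rewrite mule_ge0 ?lee_fin// integral_ge0.
Qed.

Lemma measurable_cylF d (S : measurableType d) (R : realType) (U : Type)
    (T : S -> U -> probability S R) (rho : S -> U) (As : seq (set S)) :
  (forall A, measurable A ->
    measurable_fun [set: S] (fun s => T s (rho s) A)) ->
  (forall k, measurable (nth setT As k)) ->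
  measurable_fun [set: S] (cylF T rho As).
Proof.
move=> hT; elim: As => [|A As IH] mAs /=; first exact: measurable_cst.
apply: emeasurable_funM.
  by apply/measurable_EFinP/measurable_indicP; exact: (mAs 0).
apply: (@measurable_fun_integral_kernel _ _ _ _ _ (fun s => T s (rho s))) => //.
- exact: cylF_ge0.
- by apply: IH => k; exact: (mAs k.+1).
Qed.

Lemma cylF1 d (S : measurableType d) (R : realType) (U : Type)
    (T : S -> U -> probability S R) (rho : S -> U) (A : set S) s :
  cylF T rho [:: A] s = (\1_A s)%:E.
Proof.
rewrite /= integral_cst// mul1e [X in (_ * X)%E](_ : _ = 1%E) ?mule1//.
exact: probability_setT.
Qed.

Lemma cylF2 d (S : measurableType d) (R : realType) (U : Type)
    (T : S -> U -> probability S R) (rho : S -> U) (A A' : set S) s :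
  measurable A' -> cylF T rho [:: A; A'] s = ((\1_A s)%:E * T s (rho s) A')%E.
Proof.
move=> mA'; have -> : cylF T rho [:: A; A'] s =
  ((\1_A s)%:E * \int[T s (rho s)]_(y in setT) cylF T rho [:: A'] y)%E by [].
under eq_integral do rewrite cylF1.
by rewrite integral_indic// setIT.
Qed.

(** For the empty prefix this is the pointwise bound on [A]. Each earlier set of the cylinder only
    integrates the inequality and multiplies it by an indicator. *)
Lemma cylF_next_ge d (S : measurableType d) (R : realType) (U : Type)
    (T : S -> U -> probability S R) (rho : S -> U) (As : seq (set S))
    (A A' : set S) (eps : R) s :
  (forall A, measurable A ->
    measurable_fun [set: S] (fun s => T s (rho s) A)) ->
  (forall k, measurable (nth setT As k)) -> measurable A -> measurable A' ->
  0 <= eps -> (forall s, A s -> (eps%:E <= T s (rho s) A')%E) ->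
  (eps%:E * cylF T rho (As ++ [:: A]) s <= cylF T rho (As ++ [:: A; A']) s)%E.
Proof.
move=> hT mAs mA mA' eps0 hA.
have mcat As1 As2 : (forall k, measurable (nth setT As1 k)) ->
    (forall k, measurable (nth setT As2 k)) ->
    measurable_fun [set: S] (cylF T rho (As1 ++ As2)).
  move=> mAs1 mAs2; apply: measurable_cylF => // k; rewrite nth_cat.
  by case: ifP.
have mA1 : forall k, measurable (nth setT [:: A] k).
  by case=> [|k] //=; rewrite nth_nil.
have mA2 : forall k, measurable (nth setT [:: A; A'] k).
  by case=> [|[|k]] //=; rewrite nth_nil.
elim: As mAs s => [|A1 As IH] mAs s.
  rewrite !cat0s cylF1 cylF2// indicE.
  have [/set_mem/hA h|_] := boolP (s \in A); first by rewrite mul1e mule1.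
  by rewrite mul0e mule0.
have mAs' k : measurable (nth setT As k) := mAs k.+1.
rewrite /= muleCA lee_wpmul2l ?lee_fin// -ge0_integralZl//.
- apply: ge0_le_integral => //.
  + by move=> y _; rewrite mule_ge0 ?lee_fin// cylF_ge0.
  + by apply: emeasurable_funM; [exact: measurable_cst|exact: mcat].
  + exact: mcat.
  + by move=> y _; exact: IH.
- exact: mcat.
- by move=> y _; exact: cylF_ge0.
Qed.

Lemma cylF_next_null d (S : measurableType d) (R : realType) (U : Type)
    (T : S -> U -> probability S R) (rho : S -> U) (As : seq (set S))
    (A A' : set S) s :
  measurable A' -> (forall s, A s -> T s (rho s) A' = 0%E) ->
  cylF T rho (As ++ [:: A; A']) s = 0%E.
Proof.
move=> mA' hA; elim: As s => [|A1 As IH] s.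
  rewrite cat0s cylF2// indicE.
  by have [/set_mem/hA ->|_] := boolP (s \in A); rewrite ?mule0 ?mul0e.
by rewrite /= integral0_eq ?mule0.
Qed.

(** * Recurrent cells of a single path *)

(** Otherwise nonrecurrent values would occur at infinitely many times, and by the pigeonhole
    principle one of them would recur. *)
Lemma infinitely_often_eventually (D : finType) (w : nat -> D) :
  exists N, forall n, (N <= n)%N -> infinitely_often (fun m => w m = w n).
Proof.
apply: contrapT => /forallNP no.
have [m|v iov] := @infinitely_often_pigeonhole D w
    (fun n => ~ infinitely_often (fun m => w m = w n)).
  have /existsNP[n /not_implyP[mn ?]] := no m; by exists n.
have [n [_ [nio wn]]] := iov 0%N.
apply: nio => m; have [n' [mn' [_ wn']]] := iov m.
by exists n'; rewrite wn wn'.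
Qed.

Lemma connect_trajectory (D : finType) (e : rel D) (w : nat -> D) a k :
  (forall n, (a <= n)%N -> e (w n) (w n.+1)) -> connect e (w a) (w (a + k)%N).
Proof.
move=> ew; elim: k => [|k IH]; first by rewrite addn0.
by rewrite addnS; apply: connect_trans IH (connect1 (ew _ _)); rewrite leq_addr.
Qed.

(** The deterministic core, for one fixed path: if it fails parity at an odd [i], its set [W] of
    recurrent cells is a component excluded by [no_losing_component]. *)
Lemma parity_of_component (R : realType) (d : measure_display)
    (S : measurableType d) (C U : finType) (Q : S -> C)
    (ell : nat) (B : nat -> set S)
    (Fup Flo : C -> U -> {set C}) (pi0 : C -> U) (w : nat -> S) :
  (forall c u, Flo c u \subset Fup c u) ->
  (forall c u, exists c', c' \in Fup c u) ->
  (forall i j, (1 <= i <= ell)%N -> (1 <= j <= ell)%N -> i != j ->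
    B i `&` B j = set0) ->
  (forall c, exists i, (1 <= i <= ell)%N /\ Q @^-1` [set c] `<=` B i) ->
  (forall pi1 : seq (gvertex C U) -> C * U -> gvertex C U -> R,
    p1_strategy Fup Flo pi1 ->
    forall P : probability (pathspace (gvertex C U) (gV0 (Q (w 0%N))) setT) R,
      is_game_measure pi0 pi1 P ->
      P [set r : runs (gvertex C U) (gV0 (Q (w 0%N))) |
          parity_cond ell (abs_prio (C:=C) (U:=U) Q B) r] = 1%E) ->
  (forall n, Q (w n.+1) \in Fup (Q (w n)) (pi0 (Q (w n)))) ->
  (forall c c', c' \in Flo c (pi0 c) -> infinitely_often (fun n => Q (w n) = c) ->
    infinitely_often (fun n => Q (w n) = c')) ->
  parity_cond ell B w.
Proof.
move=> lo_up up_ne Bdisj Qprio hwin wup wlo i hi oi ioi.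
apply: contrapT => nobetter.
pose W : {set C} := [set c | `[< infinitely_often (fun n => Q (w n) = c) >]]%SET.
have inW c : reflect (infinitely_often (fun n => Q (w n) = c)) (c \in W).
  by rewrite inE; exact: asboolP.
(* [ctop] is a cell that recurs at times when the path is in [B i]. *)
have [ctop iotop] := infinitely_often_pigeonhole (Q \o w) ioi.
have [N evW] := infinitely_often_eventually (Q \o w).
have NW n : (N <= n)%N -> Q (w n) \in W by move=> Nn; apply/inW/evW.
apply: (@no_losing_component R d S C U Q ell B Fup Flo pi0 (Q (w 0%N)) W
  (Q (w N)) ctop i) => //.
- exact: NW.
- rewrite -[N]add0n; apply: (@connect_trajectory _ _ (Q \o w)) => n _.
  exact: wup.
- move=> c /inW ioc; apply/fintype.subsetP => c' c'lo; apply/inW.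
  exact: wlo c'lo ioc.
- move=> c /inW ioc; have [n [Nn <-]] := ioc N.
  by exists (Q (w n.+1)) => //; apply: NW; rewrite leqW.
(* The connecting path is the trajectory itself, from a visit to [c] after time [N] to a later visit
   to [ctop]; after [N] it stays in [W]. *)
- move=> c /inW ioc; have [n [Nn <-]] := ioc N.
  have [m [nm [_ /= <-]]] := iotop n; rewrite -(subnKC nm).
  apply: (@connect_trajectory _ _ (Q \o w)) => k nk /=; rewrite wup andbT.
  by apply: NW; rewrite leqW// (leq_trans Nn).
(* The cell lies in a single [B i'] and contains a state of [B i], so disjointness forces
   [i' = i]. *)
- have [i' [hi' topB]] := Qprio ctop; have [n [_ [Bi Qn]]] := iotop 0%N.
  have [->//|ii'] := eqVneq i i'.
  have : (B i `&` B i') (w n) by split=> //; apply: topB.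
  by rewrite Bdisj.
- move=> j c hj ej /inW ioc cB; apply: nobetter; exists j; split=> // m.
  by have [n [mn Qn]] := ioc m; exists n; split=> //; apply: cB.
Qed.

(** * Almost sure behaviour of the CMP under the refined policy *)

(** The refined policy is constant on each of the finitely many measurable cells. *)
Lemma measurable_refinement d (S : measurableType d) (R : realType)
    (C U : finType) (T : S -> U -> probability S R) (Q : S -> C) (pi0 : C -> U) :
  (forall (u : U) (A : set S), measurable A ->
    measurable_fun [set: S] ((fun s => T s u A) : S -> \bar R)) ->
  (forall c, measurable (Q @^-1` [set c])) ->
  forall A, measurable A ->
    measurable_fun [set: S] (fun s => T s (refinement Q pi0 s) A).
Proof.
move=> hT mQ A mA _ Y mY; rewrite setTI.
rewrite [X in measurable X](_ : _ = \bigcup_(c in [set: C])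
    (Q @^-1` [set c] `&` (fun s => T s (pi0 c) A) @^-1` Y)).
  apply: fin_bigcup_measurable; first exact: finite_finset.
  move=> c _; apply: measurableI => //.
  by have := hT (pi0 c) A mA measurableT Y mY; rewrite setTI.
apply/seteqP; split=> s /=; rewrite /refinement.
  by move=> ?; exists (Q s).
by move=> [c _ [<-]].
Qed.

Lemma cylinder_cat (S : Type) (As t : seq (set S)) (n : nat) (w : nat -> S) :
  size As = n ->
  (forall k, (k < size (As ++ t))%N -> nth setT (As ++ t) k (w k)) <->
  (forall k, (k < n)%N -> nth setT As k (w k)) /\
  (forall k, (k < size t)%N -> nth setT t k (w (n + k)%N)).
Proof.
move=> <-; split=> [h|[h1 h2] k].
  split=> k kn; have := h k; rewrite nth_cat size_cat ?kn.
    by apply; rewrite ltn_addr.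
  move=> _; have := h (size As + k)%N.
  by rewrite nth_cat size_cat ltn_add2l [(_ + _ < _)%N]ltnNge leq_addr addKn; apply.
rewrite nth_cat size_cat; case: (ltnP k (size As)) => [kn _|nk kn]; first exact: h1.
by have := h2 (k - size As)%N; rewrite subnKC//; apply; rewrite ltn_subLR.
Qed.

Lemma measurable_cylinder (d : measure_display) (S : measurableType d)
    (As : seq (set S)) :
  (forall k, measurable (nth setT As k)) ->
  measurable [set w : pathspace S point (@measurable d S) |
    forall k, (k < size As)%N -> nth setT As k (w k)].
Proof.
move=> mAs; rewrite [X in measurable X](_ : _ =
    \bigcap_(k in [set k | (k < size As)%N])
      [set w : pathspace S point (@measurable d S) | nth setT As k (w k)]).
  by apply: bigcap_measurableType => k _; exact: measurable_coord.
by apply/seteqP; split.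
Qed.

Lemma path_steps_ae (d : measure_display) (S : measurableType d)
    (R : realType) (U C : finType) (T : S -> U -> probability S R)
    (rho : S -> U) (s : S) (Q : S -> C) (E : rel C)
    (P : probability (pathspace S point (@measurable d S)) R) :
  is_path_measure T rho s P ->
  (forall c, measurable (Q @^-1` [set c])) ->
  (forall s c', ~~ E (Q s) c' -> T s (rho s) (Q @^-1` [set c']) = 0%E) ->
  P.-negligible [set w : runs S point | exists n, ~~ E (Q (w n)) (Q (w n.+1))].
Proof.
move=> hP mQ hE.
have : P.-negligible [set w : runs S point | exists ncc : nat * C * C,
    let: (n, c, c') := ncc in
    [/\ Q (w n) = c, Q (w n.+1) = c' & ~~ E c c']].
  apply: negligible_exists => -[[n c] c'].
  have [Ecc'|nE] := boolP (E c c').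
    rewrite [X in _.-negligible X](_ : _ = set0); first exact: negligible_set0.
    by apply/seteqP; split=> w [].
  pose t := [:: Q @^-1` [set c]; Q @^-1` [set c']].
  (* The [n] copies of the full space leave the states before time [n] free. *)
  pose As := nseq n [set: S] ++ t.
  rewrite [X in _.-negligible X](_ : _ = [set w : runs S point |
      forall k, (k < size As)%N -> nth setT As k (w k)]); last first.
    apply/seteqP; split=> w /=; rewrite (cylinder_cat _ _ (size_nseq n setT)) /t /=.
      move=> [wn wn1 _]; split=> [k kn|[|[|k]]//= _]; first by rewrite nth_nseq kn.
        by rewrite addn0.
      by rewrite addn1.
    by move=> [_ h]; split=> //; [have := h 0%N isT|have := h 1%N isT];
      rewrite ?addn0 ?addn1.
  have mAs k : measurable (nth setT As k).
    rewrite /As nth_cat nth_nseq if_same; case: ifP => // _.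
    by case: (k - _)%N => [|[|j]]//=; rewrite nth_nil.
  apply/(negligibleP _ _).2; first exact: measurable_cylinder.
  apply: (etrans (hP As (fun k _ => mAs k))).
  by apply: cylF_next_null => // s' /= Qs'; apply: hE; rewrite Qs'.
move=> /(negligibleS _); apply=> w /= [n wn].
by exists (n, Q (w n), Q (w n.+1)).
Qed.

(** Both events in the hypothesis of [visits_io] are cylinders here, so that hypothesis becomes
    [cylF_next_ge]. *)
Lemma path_visits_ae (d : measure_display) (S : measurableType d)
    (R : realType) (U C : finType) (T : S -> U -> probability S R)
    (rho : S -> U) (s : S) (Q : S -> C) (c c' : C) (eps : R)
    (P : probability (pathspace S point (@measurable d S)) R) :
  is_path_measure T rho s P ->
  (forall A, measurable A ->
    measurable_fun [set: S] (fun s => T s (rho s) A)) ->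
  (forall c, measurable (Q @^-1` [set c])) ->
  0 < eps ->
  (forall s, Q s = c -> (eps%:E <= T s (rho s) (Q @^-1` [set c']))%E) ->
  P.-negligible [set w : runs S point |
    infinitely_often (fun n => Q (w n) = c) /\
    ~ infinitely_often (fun n => Q (w n) = c')].
Proof.
move=> hP mT mQ eps0 hc.
apply: (@visits_io _ _ _ P _ (fun n (w : runs S point) => Q (w n)) c c' eps) => //.
  by move=> n c1; exact: (measurable_coord (A := Q @^-1` [set c1])).
move=> m n.
(* The cell [c'] is to be avoided only from time [m] on. *)
pose A k : set S := if (m <= k)%N then ~` (Q @^-1` [set c']) else setT.
pose As := mkseq A n.
have mAs k : measurable (nth setT As k).
  rewrite /As; case: (ltnP k n) => kn; last by rewrite nth_default ?size_mkseq.
  by rewrite nth_mkseq// /A; case: ifP => // _; exact: measurableC.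
have mcat t k : (forall k, measurable (nth setT t k)) ->
    measurable (nth setT (As ++ t) k).
  by move=> mt; rewrite nth_cat; case: ifP.
have AsE (w : nat -> S) :
    (forall k, (k < n)%N -> nth setT As k (w k)) <->
    (forall k, (m <= k < n)%N -> Q (w k) <> c').
  split=> h k.
    by move=> /andP[mk kn]; have := h k kn; rewrite nth_mkseq// /A mk.
  move=> kn; rewrite nth_mkseq// /A; case: ifP => // mk; apply: h.
  by rewrite mk.
have mc k : measurable (nth setT [:: Q @^-1` [set c]] k).
  by case: k => [|k] //=; rewrite nth_nil.
have mcc' k : measurable (nth setT [:: Q @^-1` [set c]; Q @^-1` [set c']] k).
  by case: k => [|[|k]] //=; rewrite nth_nil.
have h1 := hP (As ++ [:: Q @^-1` [set c]]) (fun k _ => mcat _ _ mc).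
have h2 := hP (As ++ [:: Q @^-1` [set c]; Q @^-1` [set c']]) (fun k _ => mcat _ _ mcc').
rewrite [X in (_ * P X)%E](_ : _ = [set w : runs S point |
    forall k, (k < size (As ++ [:: Q @^-1` [set c]]))%N ->
      nth setT (As ++ [:: Q @^-1` [set c]]) k (w k)]); last first.
  apply/seteqP; split=> w /=; rewrite (cylinder_cat _ _ (size_mkseq A n)) AsE.
    by move=> [h wn]; split=> // -[|k]//= _; rewrite addn0.
  by move=> [h /(_ 0%N isT)]; rewrite addn0.
rewrite [X in (_ <= P X)%E](_ : _ = [set w : runs S point |
    forall k, (k < size (As ++ [:: Q @^-1` [set c]; Q @^-1` [set c']]))%N ->
      nth setT (As ++ [:: Q @^-1` [set c]; Q @^-1` [set c']]) k (w k)]); last first.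
  apply/seteqP; split=> w /=; rewrite (cylinder_cat _ _ (size_mkseq A n)) AsE.
    by move=> [h wn wn1]; split=> // -[|[|k]]//= _; rewrite ?addn0 ?addn1.
  by move=> [h h']; split=> //; [have := h' 0%N isT|have := h' 1%N isT];
    rewrite ?addn0 ?addn1.
rewrite h1 h2; apply: cylF_next_ge => //; exact: ltW.
Qed.

(** * From almost sure path properties to the parity condition *)

Unset Implicit Arguments.

Theorem theorem4
  (R : realType) (d : measure_display) (S : measurableType d) (U : finType)
  (T : S -> U -> probability S R)
  (hT : forall (u : U) (A : set S), measurable A ->
          measurable_fun [set: S] ((fun s => T s u A) : S -> \bar R))
  (ell : nat) (B : nat -> set S)
  (hBmeas : forall i, (1 <= i <= ell)%N -> measurable (B i))
  (hBdisj : forall i j, (1 <= i <= ell)%N -> (1 <= j <= ell)%N -> i != j ->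
              B i `&` B j = set0)
  (hBcover : forall s, exists i, (1 <= i <= ell)%N /\ B i s)
  (C : finType) (Q : S -> C)
  (hQmeas : forall c, measurable (Q @^-1` [set c]))
  (hQne : forall c, exists s, Q s = c)
  (hQprio : forall c, exists i, (1 <= i <= ell)%N /\ Q @^-1` [set c] `<=` B i)
  (Fup Flo : C -> U -> {set C})
  (hFup : forall c u c',
            (exists s, Q s = c /\ (0 < T s u (Q @^-1` [set c']))%E) ->
            c' \in Fup c u)
  (hFlo : forall c u c', c' \in Flo c u ->
            exists eps : R, 0 < eps /\
              forall s, Q s = c -> (eps%:E <= T s u (Q @^-1` [set c']))%E)
  (shat : C) (pi0 : C -> U)
  (hwin : forall pi1 : seq (gvertex C U) -> C * U -> gvertex C U -> R,
            p1_strategy Fup Flo pi1 ->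
            forall P : probability (pathspace (gvertex C U) (gV0 shat) setT) R,
              is_game_measure pi0 pi1 P ->
              P [set w : runs (gvertex C U) (gV0 shat) |
                  parity_cond ell (abs_prio (C:=C) (U:=U) Q B) w] = 1%E) :
  Q @^-1` [set shat] `<=` WinDom T ell B (refinement Q pi0).

Proof.
have lo_up c u : Flo c u \subset Fup c u.
  apply/fintype.subsetP => c' /hFlo[eps [eps0 Teps]]; have [s Qs] := hQne c.
  apply: hFup; exists s; split=> //; apply: lt_le_trans (Teps s Qs).
  by rewrite lte_fin.
(* Otherwise every cell would be null for [T s u], while finitely many cells cover the space, which
   has mass 1. *)
have up_ne c u : exists c', c' \in Fup c u.
  have [s Qs] := hQne c; apply: contrapT => /forallNP no.
  have : (T s u).-negligible [set y | exists c', Q y = c'].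
    apply: negligible_exists => c'; apply/(negligibleP _ (hQmeas c')).2.
    apply/eqP; apply: contraT => T0; case: (no c'); apply: hFup.
    by exists s; split=> //; rewrite lt0e T0 measure_ge0.
  rewrite (_ : [set y | _] = setT); last by apply/seteqP; split=> // y _; exists (Q y).
  move=> /(negligibleP _ measurableT).1 T0.
  by have /eqP := etrans (esym (probability_setT (T s u))) T0; rewrite onee_eq0.
move=> s /= Qs P hP.
have mT := measurable_refinement pi0 hT hQmeas.
pose par : set (pathspace S point (@measurable d S)) := [set w | parity_cond ell B w].
have mpar : measurable par.
  apply: measurable_parity_cond => i n hi; apply: measurable_coord.
  exact: hBmeas.
(* The one-set cylinder on the complement of [shat] has as its probability an indicator that
   vanishes at [s]. *)
have start : P.-negligible [set w : runs S point | Q (w 0%N) <> shat].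
  have mC : measurable (~` (Q @^-1` [set shat])) by exact: measurableC.
  apply/(negligibleP _ _).2.
    exact: (measurable_coord (A := ~` (Q @^-1` [set shat]))).
  have m1 k : (k < size [:: ~` (Q @^-1` [set shat])])%N ->
      measurable (nth setT [:: ~` (Q @^-1` [set shat])] k) by case: k.
  rewrite [X in _ X = _](_ : _ = [set w : runs S point |
      forall k, (k < size [:: ~` (Q @^-1` [set shat])])%N ->
        nth setT [:: ~` (Q @^-1` [set shat])] k (w k)]).
    apply: (etrans (hP _ m1)); rewrite cylF1 indicE memNset//=.
  by apply/seteqP; split=> w /= => [? [|]//|/(_ 0%N isT)].
have steps := path_steps_ae (E := fun c c' => c' \in Fup c (pi0 c)) hP hQmeas.
have visits : P.-negligible [set w : runs S point | exists cc : C * C,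
    [/\ cc.2 \in Flo cc.1 (pi0 cc.1), infinitely_often (fun n => Q (w n) = cc.1) &
        ~ infinitely_often (fun n => Q (w n) = cc.2)]].
  apply: negligible_exists => -[c c'] /=.
  have [/hFlo[eps [eps0 Teps]]|nlo] := boolP (c' \in Flo c (pi0 c)); last first.
    rewrite [X in _.-negligible X](_ : _ = set0); first exact: negligible_set0.
    by apply/seteqP; split=> w [].
  have : P.-negligible [set w : runs S point |
      infinitely_often (fun n => Q (w n) = c) /\
      ~ infinitely_often (fun n => Q (w n) = c')].
    apply: (path_visits_ae hP mT hQmeas eps0) => s' Qs'.
    by rewrite /refinement Qs'; exact: Teps.
  by move=> /(negligibleS _); apply=> w [].
(* Off the three null sets a path starts in [shat], follows [Fup], and has recurrent cells closed
   under [Flo], as [parity_of_component] requires. *)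
have N : P.-negligible (~` par).
  apply: (negligibleS _ (negligibleU (negligibleU start (steps _)) visits)).
    move=> w npar; apply: contrapT.
    move=> /not_orP[/not_orP[/contrapT w0 /forallNP wup] /forallNP wlo].
    apply: npar; apply: (@parity_of_component R d S C U Q ell B Fup Flo pi0 w) => //.
    - by rewrite w0.
    - by move=> n; have /negP := wup n; rewrite negbK.
    - by move=> c c' c'lo ioc; apply: contrapT => nio; exact: (wlo (c, c')).
  (* This is the condition left open in [steps]: by the contrapositive of [hFup], cells outside
     [Fup] are entered with probability 0. *)
  move=> s' c' nup; apply/eqP; apply: contraNT nup => T0.
  by apply: hFup; exists s'; split=> //; rewrite lt0e T0 measure_ge0.
have P0 := (negligibleP _ (measurableC mpar)).1 N.
have := probability_setC P (measurableC mpar); rewrite setCK => ->.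
by rewrite P0 sube0.
Qed.
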